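(* Let $(G,+)$ be a commutative inverse semigroup containing at least two idempotents, and let $E$ be a subsemiring of $\mathrm{End}(G)$ such that $\mathbf{M}_G \subseteq E$ and $E$ is separated by idempotents. Then $E$ is subdirectly irreducible and its monolith is $\mathscr{R}|_E$, where $\mathscr{R}=\mathscr{R}_I\cap\mathscr{R}_L$ and $\mathscr{R}|_E = \mathscr{R}\cap (E\times E)$.
   Context: An inverse semigroup is a semigroup in which each element $s$ has a unique inverse $s'$; additively, $s+s'+s=s$ and $s'+s+s'=s'$. $E(G)$ denotes the set of idempotents of $G$. A semiring is a set with two associative operations $+,\cdot$ such that $\cdot$ distributes over $+$ on both sides (no zero or identity is required). For a commutative inverse semigroup $(G,+)$, $\mathrm{End}(G)$ is the semiring of all semigroup endomorphisms of $G$, with pointwise addition and with composition $(f\cdot g)(x)=f(g(x))$ as multiplication. For $a,b\in G$ write $a\leq_q b$ if and only if $a+a'+b=b$ (a quasi-order on $G$). For $a\in G$, $\lambda_a\in \mathrm{End}(G)$ is the constant map $\lambda_a(x)=a+a'$ for all $x\in G$. For $a,b,c\in G$ with $a\leq_q b$, $\mu_{a,b,c}\in\mathrm{End}(G)$ is defined by $\mu_{a,b,c}(x)=a+a'$ if $x\leq_q c$ and $\mu_{a,b,c}(x)=b+b'$ if $x\not\leq_q c$. $\mathbf{M}_G$ is the subsemiring of $\mathrm{End}(G)$ generated by all $\mu_{a,b,c}$ with $a,b,c\in G$, $a\leq_q b$. A nonempty subset $A\subseteq \mathrm{End}(G)$ with at least two elements is separated by idempotents if for any $f,g\in A$ with $f\neq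 g$ there exists $e\in E(G)$ with $f(e)\neq g(e)$. Relations on $\mathrm{End}(G)$: $f\,\mathscr{R}_I\,g$ if and only if $f+\lambda_a=g+\lambda_a$ for some $a\in G$. $f\,\mathscr{R}_L\,g$ if and only if both of the following hold: (i) the range of $f$ is a lower bounded subset of $G$, i.e. there exists $a\in G$ such that $a\leq_q f(x)$ for all $x\in G$; (ii) the range of $g$ is a lower bounded subset of $G$, i.e. there exists $b\in G$ such that $b\leq_q g(x)$ for all $x\in G$. A semiring is subdirectly irreducible if it has at least two elements and among its non-identity (semiring) congruences there is a least one; this least non-identity congruence is called its monolith.
   Formalization: The monolith is stated as R|_E together with the diagonal of E, since with R_L as given R|_E is not reflexive when some element of E has a range without lower bound (e.g. the identity map for G = (Z, max), E = End(G)); the two agree whenever R|_E is reflexive. *)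

(* Defs.v *)
From HB Require Import structures.
From Stdlib Require Import Relations.
From mathcomp Require Import all_boot all_algebra.
From mathcomp Require Import boolp classical_sets.

Set Implicit Arguments.
Unset Strict Implicit.
Unset Printing Implicit Defensive.

Local Open Scope classical_set_scope.
Local Open Scope ring_scope.

(* Semirings without zero and identity, and without commutativity of addition;
   the product is the one of magmaType, written ( _ * _ )%g.                  *)
HB.mixin Record isBareSemiRing S of Algebra.BaseAddMagma S & Magma S := {
  bare_addA : forall x y z : S, x + (y + z) = (x + y) + z;
  bare_mulA : forall x y z : S, (x * (y * z) = (x * y) * z)%g;
  bare_mulDl : forall x y z : S, ((x + y)%R * z)%g = (x * z)%g + (y * z)%g;
  bare_mulDr : forall x y z : S, (x * (y + z)%R)%g = (x * y)%g + (x * z)%g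
}.

#[short(type="bareSemiRingType")]
HB.structure Definition BareSemiRing :=
  {S of isBareSemiRing S & Algebra.BaseAddMagma S & Magma S}.

Definition subsemiring_closed (S : bareSemiRingType) (A : set S) : Prop :=
  (forall x y, A x -> A y -> A (x + y)) /\
  (forall x y, A x -> A y -> A (x * y)%g).

Record subBareSemiRing (S : bareSemiRingType) := SubBareSemiRing {
  subsemi_set :> set S;
  subsemi_closed : subsemiring_closed subsemi_set
}.

Section SubBareSemiRing.
Variables (S : bareSemiRingType) (E : subBareSemiRing S).

Definition subsemi_add (x y : E) : E :=
  SigSub (mem_set ((subsemi_closed E).1 _ _ (set_valP x) (set_valP y))).
Definition subsemi_mul (x y : E) : E :=
  SigSub (mem_set ((subsemi_closed E).2 _ _ (set_valP x) (set_valP y))).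

HB.instance Definition _ := Algebra.hasAdd.Build (set_type E) subsemi_add.
HB.instance Definition _ := hasMul.Build (set_type E) subsemi_mul.

Let addA (x y z : E) : x + (y + z) = (x + y) + z.
Proof. by apply: val_inj; apply: bare_addA. Qed.
Let mulA (x y z : E) : (x * (y * z) = (x * y) * z)%g.
Proof. by apply: val_inj; apply: bare_mulA. Qed.
Let mulDl (x y z : E) : ((x + y)%R * z)%g = (x * z)%g + (y * z)%g.
Proof. by apply: val_inj; apply: bare_mulDl. Qed.
Let mulDr (x y z : E) : (x * (y + z)%R)%g = (x * y)%g + (x * z)%g.
Proof. by apply: val_inj; apply: bare_mulDr. Qed.

HB.instance Definition _ :=
  isBareSemiRing.Build (set_type E) addA mulA mulDl mulDr.
End SubBareSemiRing.

Section Congruences.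
Variable S : bareSemiRingType.
Implicit Type r : relation S.

Definition congruence r : Prop :=
  [/\ equivalence S r,
      forall x x' y y', r x x' -> r y y' -> r (x + y) (x' + y') &
      forall x x' y y', r x x' -> r y y' -> r (x * y)%g (x' * y')%g].

Definition nonidentity r : Prop := exists x y, r x y /\ x <> y.

Definition is_monolith r : Prop :=
  [/\ congruence r, nonidentity r &
      forall r', congruence r' -> nonidentity r' -> inclusion S r r'].
End Congruences.

Definition subdirectly_irreducible (S : bareSemiRingType) : Prop :=
  (exists x y : S, x <> y) /\ exists r : relation S, is_monolith r.

HB.mixin Record AddSemigroup_isInverse G of Algebra.AddSemigroup G := {
  sinv : G -> G;
  addsVs : forall x : G, x + sinv x + x = x;
  addVsV : forall x : G, sinv x + x + sinv x = sinv x;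
  sinv_uniq : forall x y : G, x + y + x = x -> y + x + y = y -> y = sinv x
}.

#[short(type="addInvSemigroupType")]
HB.structure Definition AddInvSemigroup :=
  {G of AddSemigroup_isInverse G & Algebra.AddSemigroup G}.

Section Endomorphisms.
Variable G : addInvSemigroupType.
Implicit Types a b c x y : G.

Definition idempotents : set G := [set e | e + e = e].

Record endo := Endo {
  endo_fun :> G -> G;
  endoD : {morph endo_fun : x y / x + y}
}.

Lemma endo_ext (f g : endo) : f =1 g -> f = g.
Proof.
case: f g => [f fD] [g gD] /= /funext fg; rewrite -fg in gD *.
by congr Endo; apply: Prop_irrelevance.
Qed.

Fact endo_addD (f g : endo) : {morph (fun x => f x + g x) : x y / x + y}.
Proof. by move=> x y; rewrite !endoD Algebra.addrACA. Qed.
Fact endo_compD (f g : endo) : {morph (fun x => f (g x)) : x y / x + y}.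
Proof. by move=> x y; rewrite !endoD. Qed.

HB.instance Definition _ :=
  Algebra.hasAdd.Build endo (fun f g => Endo (endo_addD f g)).
HB.instance Definition _ :=
  hasMul.Build endo (fun f g => Endo (endo_compD f g)).

Let addA (f g h : endo) : f + (g + h) = (f + g) + h.
Proof. by apply: endo_ext => x; apply: Algebra.addrA. Qed.
Let mulA (f g h : endo) : (f * (g * h) = (f * g) * h)%g.
Proof. exact: endo_ext. Qed.
Let mulDl (f g h : endo) : ((f + g)%R * h)%g = (f * h)%g + (g * h)%g.
Proof. exact: endo_ext. Qed.
Let mulDr (f g h : endo) : (f * (g + h)%R)%g = (f * g)%g + (f * h)%g.
Proof. by apply: endo_ext => x; apply: endoD. Qed.

HB.instance Definition _ := isBareSemiRing.Build endo addA mulA mulDl mulDr.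

Definition le_q a b : Prop := a + sinv a + b = b.

Fact addsV_idem a : (a + sinv a) + (a + sinv a) = a + sinv a.
Proof. by rewrite Algebra.addrA addsVs. Qed.

Fact sinvD a b : sinv (a + b) = sinv a + sinv b.
Proof.
apply/esym/sinv_uniq; first by
  rewrite (Algebra.addrACA a) [LHS]Algebra.addrACA !addsVs.
by rewrite (Algebra.addrACA (sinv a)) [LHS]Algebra.addrACA !addVsV.
Qed.

Fact lambda_subproof a : {morph (fun _ : G => a + sinv a) : x y / x + y}.
Proof. by move=> x y; rewrite addsV_idem. Qed.
Definition lambda a : endo := Endo (lambda_subproof a).

Fact le_q_add x y c : le_q (x + y) c <-> le_q x c /\ le_q y c.
Proof.
rewrite /le_q sinvD Algebra.addrACA; split=> [h|[hx hy]];
  last by rewrite -Algebra.addrA hy.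
split; first by rewrite -h !Algebra.addrA addsVs.
by rewrite -h [x + sinv x + _]Algebra.addrC !Algebra.addrA addsVs.
Qed.

Fact mu_subproof a b c : le_q a b ->
  {morph (fun x => if `[< le_q x c >] then a + sinv a else b + sinv b)
     : x y / x + y}.
Proof.
move=> ab x y; have /asbool_equiv_eq -> := le_q_add x y c.
rewrite asbool_and; have ab' : a + sinv a + (b + sinv b) = b + sinv b.
  by rewrite Algebra.addrA ab.
by case: `[< le_q x c >]; case: `[< le_q y c >];
  rewrite /= ?addsV_idem ?ab' // [RHS]Algebra.addrC ab'.
Qed.
Definition mu a b c (ab : le_q a b) : endo := Endo (mu_subproof c ab).

Definition M_ : set endo :=
  smallest (@subsemiring_closed endo)
    [set f | exists a b c (ab : le_q a b), f = mu c ab].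

Definition separated_by_idempotents (A : set endo) : Prop :=
  (exists f g, [/\ A f, A g & f <> g]) /\
  forall f g, A f -> A g -> f <> g ->
    exists e, idempotents e /\ f e <> g e.

Definition R_I : relation endo := fun f g =>
  exists a, f + lambda a = g + lambda a.

Definition lower_bounded (A : set G) : Prop :=
  exists a, forall x, A x -> le_q a x.

Definition R_L : relation endo := fun f g =>
  lower_bounded (range f) /\ lower_bounded (range g).

Definition R_ : relation endo := fun f g => R_I f g /\ R_L f g.

(* R_L, hence R_, relates f to itself only if the range of f is lower bounded
   (which fails for f = id on the integers under max). When A has an element of
   unbounded range, R_restr A is not reflexive and has to be completed by the
   diagonal to be a congruence.                                              *)
Definition R_restr (A : set endo) : relation A :=
  fun f g => R_ (val f) (val g).

End Endomorphisms.

Arguments M_ : clear implicits.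
Arguments R_restr {G} A _ _.

(* Main.v *)
(* If a congruence of E identifies f <> g, then f e <> g e for some idempotent
   e, and we may assume that f e is not below g e. Composing with mu_{a,b,c}
   on the left, for c = g e, and with lambda_e on the right turns the pair
   (f, g) into (lambda_b, lambda_a) for any a <=_q b. As a and b lie below
   a + b, the congruence identifies all the constant maps lambda_a.
   If now f + lambda_a = g + lambda_a and the ranges of f and g are bounded
   below by c and d, then f = f + lambda_c ~ f + lambda_a = g + lambda_a
   ~ g + lambda_d = g, so R_ is contained in every nonidentity congruence. *)
Require Import Defs.
From mathcomp Require Import all_boot all_algebra.
From mathcomp Require Import boolp classical_sets.
From Stdlib Require Import Relations.
Local Open Scope classical_set_scope.

(** * The quasi-order, endomorphisms and constant maps *)

Section InverseSemigroup.
Local Open Scope ring_scope.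
Local Set Implicit Arguments.
Local Unset Strict Implicit.
Context {G : addInvSemigroupType}.
Implicit Types (a b c e x y : G) (f g h : endo G).

Lemma le_q_refl a : le_q a a.
Proof. exact: addsVs. Qed.

Lemma sinv_idem e : idempotents e -> sinv e = e.
Proof. by move=> ee; apply/esym/sinv_uniq; rewrite !ee. Qed.

Lemma le_q_idem e x : idempotents e -> le_q e x <-> e + x = x.
Proof. by move=> ee; rewrite /le_q sinv_idem // ee. Qed.

(** On idempotents [le_q] is the join-semilattice order [e + x = x], so commutativity gives
    antisymmetry. *)
Lemma le_q_idem_anti e x :
  idempotents e -> idempotents x -> le_q e x -> le_q x e -> e = x.
Proof.
move=> ee xx ex xe; have /le_q_idem := ex => /(_ ee) <-.
by have /le_q_idem := xe => /(_ xx) {1}<-; rewrite Algebra.addrC.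
Qed.

Lemma le_q_addr a b : le_q a (a + b).
Proof. by rewrite /le_q Algebra.addrA addsVs. Qed.

Lemma le_q_addl a b : le_q b (a + b).
Proof. by rewrite Algebra.addrC; apply: le_q_addr. Qed.

Lemma le_q_addW a b c : le_q a b -> le_q a (b + c).
Proof. by rewrite /le_q Algebra.addrA => ->. Qed.

Lemma endo_sinv f x : f (sinv x) = sinv (f x).
Proof. by apply: sinv_uniq; rewrite -!endoD ?addsVs ?addVsV. Qed.

Lemma endo_idem f e : idempotents e -> idempotents (f e).
Proof. by move=> ee; rewrite /idempotents /= -endoD ee. Qed.

Lemma endo_le_q f a b : le_q a b -> le_q (f a) (f b).
Proof. by rewrite /le_q -endo_sinv -!endoD => ->. Qed.

Lemma endo_addC f g : f + g = g + f.
Proof. by apply: endo_ext => x /=; rewrite Algebra.addrC. Qed.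

Lemma lambdaD a b : lambda (a + b) = lambda a + lambda b.
Proof. by apply: endo_ext => x /=; rewrite sinvD Algebra.addrACA. Qed.

(** For [b = a] both branches of [mu] agree; this is what puts the constant maps into [M_ G]. *)
Lemma mu_lambda a c : mu c (le_q_refl a) = lambda a.
Proof. by apply: endo_ext => x /=; case: ifP. Qed.

Lemma mu_in_M a b c (ab : le_q a b) : M_ G (mu c ab).
Proof. by move=> A [_ sub]; apply: sub; exists a, b, c, ab. Qed.

Lemma lambda_in_M a : M_ G (lambda a).
Proof. by rewrite -(mu_lambda a a); apply: mu_in_M. Qed.

Lemma add_lambda f c : (forall x, range f x -> le_q c x) -> f + lambda c = f.
Proof.
move=> lef; apply: endo_ext => x /=; rewrite Algebra.addrC.
by apply: lef; exists x.
Qed.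

(** * Compatibility of [R_] with the semiring operations *)

Lemma R_sym f g : R_ f g -> R_ g f.
Proof. by move=> [[a fg] [lf lg]]; split=> //; exists a. Qed.

Lemma R_trans f g h : R_ f g -> R_ g h -> R_ f h.
Proof.
(* [lambda (a + b)] splits as [lambda a + lambda b], so both given equations can be applied in
   turn. *)
move=> [[a fg] [lf _]] [[b gh] [_ lh]]; split=> //; exists (a + b).
by rewrite lambdaD bare_addA fg -bare_addA (endo_addC (lambda a)) !bare_addA gh.
Qed.

(** Adding moves values up in [le_q], so a lower bound survives even when the range of [h] is
    unbounded. *)
Lemma R_addr f g h : R_ f g -> R_ (f + h) (g + h).
Proof.
have lbD (k : endo G) : lower_bounded (range k) -> lower_bounded (range (k + h)).
  move=> [a ak]; exists a => _ [x _ <-] /=.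
  by apply: le_q_addW; apply: ak; exists x.
move=> [[a fg] [lf lg]]; split; last by split; apply: lbD.
by exists a; rewrite ![_ + h]endo_addC -!bare_addA fg.
Qed.

Lemma R_mulr f g h : R_ f g -> R_ (f * h)%g (g * h)%g.
Proof.
have lbM (k : endo G) : lower_bounded (range k) -> lower_bounded (range (k * h)%g).
  by move=> [a ak]; exists a => _ [x _ <-] /=; apply: ak; exists (h x).
move=> [[a fg] [lf lg]]; split; last by split; apply: lbM.
exists a; apply: endo_ext => x.
by apply: (congr1 (fun k : endo G => k (h x)) fg).
Qed.

(** Since [h] preserves inverses and [le_q], both kinds of witness [a] are carried to [h a]. *)
Lemma R_mull f g h : R_ f g -> R_ (h * f)%g (h * g)%g.
Proof.
have lbM (k : endo G) : lower_bounded (range k) -> lower_bounded (range (h * k)%g).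
  move=> [a ak]; exists (h a) => _ [x _ <-] /=.
  by apply: endo_le_q; apply: ak; exists x.
move=> [[a fg] [lf lg]]; split; last by split; apply: lbM.
exists (h a); apply: endo_ext => x /=.
rewrite -endo_sinv -!endoD; congr (h _).
by apply: (congr1 (fun k : endo G => k x) fg).
Qed.

End InverseSemigroup.

(** * The reflexive closure of [R_] on [E] is a congruence *)

Section Congruence.
Local Open Scope ring_scope.
Local Set Implicit Arguments.
Local Unset Strict Implicit.

(** Checking translations only avoids combining a diagonal pair of [clos_refl] with a pair of
    [R_]. *)
Lemma one_sided_congruence (S : bareSemiRingType) (r : relation S) :
  equivalence S r ->
  (forall x y z, r x y -> r (x + z) (y + z)) ->
  (forall x y z, r x y -> r (z + x) (z + y)) ->
  (forall x y z, r x y -> r (x * z)%g (y * z)%g) ->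
  (forall x y z, r x y -> r (z * x)%g (z * y)%g) ->
  congruence r.
Proof.
move=> eqr addr addl mulr mull; have [_ tr _] := eqr; split=> //.
- by move=> x x' y y' xx' yy'; apply: tr (addr _ _ _ xx') (addl _ _ _ yy').
- by move=> x x' y y' xx' yy'; apply: tr (mulr _ _ _ xx') (mull _ _ _ yy').
Qed.

Lemma clos_refl_homo {S : Type} {r : relation S} (h : S -> S) :
  (forall x y, r x y -> r (h x) (h y)) ->
  forall x y, clos_refl S r x y -> clos_refl S r (h x) (h y).
Proof. by move=> hr x _ [y /hr|]; [apply: r_step|apply: r_refl]. Qed.

Context {G : addInvSemigroupType} {E : subBareSemiRing (endo G)}.

Lemma R_restr_congruence : congruence (clos_refl E (R_restr E)).
Proof.
apply: one_sided_congruence.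
- split.
  + exact: r_refl.
  + move=> x y z [{}y xy|//] [{}z yz|]; last exact: r_step.
    exact/r_step/(R_trans xy yz).
  + by move=> x y [{}y xy|]; [apply/r_step/R_sym|apply: r_refl].
- by move=> x y z; apply: (clos_refl_homo (h := fun t => t + z)) => {}x {}y; apply: R_addr.
- move=> x y z; apply: (clos_refl_homo (h := fun t => z + t)) => {}x {}y xy.
  by rewrite /R_restr /= ![val z + _]endo_addC; apply: R_addr.
- by move=> x y z; apply: (clos_refl_homo (h := fun t => t * z)%g) => {}x {}y; apply: R_mulr.
- by move=> x y z; apply: (clos_refl_homo (h := fun t => z * t)%g) => {}x {}y; apply: R_mull.
Qed.

(** * Nonidentity and minimality *)

Context (ME : M_ G `<=` E).

Definition sub_lambda (a : G) : E := SigSub (mem_set (ME (lambda_in_M a))).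
Definition sub_mu {a b : G} (c : G) (ab : le_q a b) : E :=
  SigSub (mem_set (ME (mu_in_M c ab))).

Lemma R_restr_nonidentity (e f : G) :
  idempotents e -> idempotents f -> e <> f ->
  nonidentity (clos_refl E (R_restr E)).
Proof.
move=> ee ff ef; exists (sub_lambda e), (sub_lambda f); split; last first.
  move=> /(congr1 (fun k : E => val k e)) /=.
  by rewrite !sinv_idem // ee ff.
have lb a : lower_bounded (range (lambda a)).
  by exists a => _ [x _ <-]; apply: le_q_addr.
apply: r_step; split; last by split; apply: lb.
(* The idempotent [e + f] absorbs [e] and [f], so both sums are constant with value [e + f]. *)
exists (e + f); rewrite lambdaD.
apply: endo_ext => x /=.
by rewrite !sinv_idem // ee ff [in RHS](Algebra.addrC e) !Algebra.addrA ee ff Algebra.addrC.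
Qed.

Lemma congruence_lambda_of_nle (r : relation E) (f g : E) (e a b : G) :
  congruence r -> r f g -> idempotents e ->
  ~ le_q (val f e) (val g e) -> le_q a b -> r (sub_lambda b) (sub_lambda a).
Proof.
move=> [[refl _ _] _ mulr] fg ee nle ab.
have := mulr _ _ _ _ (refl (sub_mu (val g e) ab))
  (mulr _ _ _ _ fg (refl (sub_lambda e))).
(* The threshold [g e] rejects [f e], giving [b + sinv b], and accepts itself, giving
   [a + sinv a]. *)
congr r; apply/val_inj/endo_ext => x /=; rewrite sinv_idem // ee.
  by rewrite asboolF.
by rewrite asboolT //; apply: le_q_refl.
Qed.

Context (sepE : separated_by_idempotents E).

Lemma congruence_lambda (r : relation E) (a b : G) :
  congruence r -> nonidentity r -> r (sub_lambda a) (sub_lambda b).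
Proof.
move=> cr [f [g [fg nfg]]]; have [[_ tr sy] _ _] := cr.
have [|e [ee nfge]] := sepE.2 _ _ (set_valP f) (set_valP g).
  by move=> /val_inj.
have up c d : le_q c d -> r (sub_lambda d) (sub_lambda c).
  (* If [f e] is below [g e], exchange [f] and [g]: the reverse relation would force [f e = g e] by
     antisymmetry. *)
  have [fge|] := pselect (le_q (val f e) (val g e)); last exact: congruence_lambda_of_nle.
  apply: (congruence_lambda_of_nle (f := g) (g := f) (e := e)) => //; first exact: sy.
  by move=> gfe; apply: nfge; apply: le_q_idem_anti => //; apply: endo_idem.
by apply: tr (up b _ (le_q_addl a b)); apply/sy/up/le_q_addr.
Qed.

Lemma R_restr_least (r : relation E) :
  congruence r -> nonidentity r -> inclusion E (clos_refl E (R_restr E)) r.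
Proof.
move=> cr nr f _ [g|]; have [[refl tr sy] addr _] := cr; last exact: refl.
move=> [[a fg] [[c cf] [d dg]]].
(* [k] absorbs [lambda b] for a lower bound [b], and [r] exchanges [lambda b] for [lambda a]. *)
have shift (k : E) b : (forall x, range (val k) x -> le_q b x) ->
    r k (k + sub_lambda a).
  move=> bk; have := addr _ _ _ _ (refl k) (congruence_lambda b a cr nr).
  by have -> : k + sub_lambda b = k by apply/val_inj/add_lambda.
apply: tr (shift f c cf) _.
have -> : f + sub_lambda a = g + sub_lambda a by apply: val_inj.
exact: sy (shift g d dg).
Qed.

End Congruence.

(* clos_refl adds the diagonal of E, without which the restriction of R_ need
   not be reflexive, see the remark before R_restr.                          *)
Theorem theorem2p12 (G : addInvSemigroupType)
    (G2 : exists e f : G, [/\ idempotents e, idempotents f & e <> f])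
    (E : subBareSemiRing (endo G))
    (ME : M_ G `<=` E)
    (sepE : separated_by_idempotents E) :
  subdirectly_irreducible E /\ is_monolith (clos_refl E (R_restr E)).
Proof.
have [e [f [ee ff ef]]] := G2.
have nidR := R_restr_nonidentity ME ee ff ef.
have monR : is_monolith (clos_refl E (R_restr E)).
  by split=> // [|r]; [apply: R_restr_congruence|apply: R_restr_least].
split=> //; split; last by exists (clos_refl E (R_restr E)).
by have [x [y [_ xy]]] := nidR; exists x, y.
Qed.
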